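(* Let $W\in\mathbb{R}^{m\times r}$ be entrywise nonnegative of full column rank $r$, let $A=W^\top W$, and let $\mathsf{m}\in\mathbb{R}^m$ be entrywise nonnegative. Let $\mathcal{E}=\{\xi\in\mathbb{R}^r:\langle A\xi,\xi\rangle=1\}$ and let $\phi(h)=1-\langle \mathsf{m},Wh\rangle$ for $h\in\mathbb{R}^r$. Then for every entrywise nonnegative $h\in\mathcal{E}$, the Riemannian gradient of $\phi|_{\mathcal{E}}$ at $h$ is $$\operatorname{grad}\phi(h)=\Big(I_r-\frac{(Ah)(Ah)^\top}{\|Ah\|_2^2}\Big)\big(-W^\top \mathsf{m}\big)=\operatorname{grad}^+\phi(h)-\operatorname{grad}^-\phi(h),$$ where $$\operatorname{grad}^+\phi(h)=\frac{(Ah)(Ah)^\top}{\|Ah\|_2^2}\,W^\top \mathsf{m},\qquad \operatorname{grad}^-\phi(h)=W^\top \mathsf{m},$$ and both $\operatorname{grad}^+\phi(h)$ and $\operatorname{grad}^-\phi(h)$ are entrywise nonnegative.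
   Context: $\langle\cdot,\cdot\rangle$ and $\|\cdot\|_2$ are the standard Euclidean inner product and norm. The tangent space of $\mathcal{E}$ at $h$ is $T_h\mathcal{E}=\{\xi\in\mathbb{R}^r:\langle Ah,\xi\rangle=0\}$. The Riemannian gradient of the restriction $\phi|_{\mathcal{E}}$ at $h\in\mathcal{E}$, with $\mathcal{E}$ carrying the standard Euclidean metric, is the Euclidean gradient $\nabla\phi(h)$ projected orthogonally (in the standard Euclidean inner product) onto $T_h\mathcal{E}$. *)

(* Defs.v *)
From HB Require Import structures.
From mathcomp Require Import all_boot all_order all_algebra.
From mathcomp Require Import all_classical all_reals all_analysis.
Set Implicit Arguments.
Unset Strict Implicit.
Unset Printing Implicit Defensive.
Import Order.TTheory GRing.Theory Num.Theory.
Import numFieldNormedType.Exports.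
Local Open Scope classical_set_scope.
Local Open Scope ring_scope.

Section Euclidean.
Context {R : realType} {n : nat}.
Implicit Types x y p g h : 'cV[R]_n.

Definition dot x y : R := \sum_(i < n) x i 0 * y i 0.

(* The norm `|x| that the library puts on matrices is the sup norm, hence a
   separate Euclidean norm.  Both induce the same topology, so the notion of
   differentiability used below does not depend on this choice. *)
Definition norm2 x : R := Num.sqrt (dot x x).

Definition is_gradient (f : 'cV[R]_n -> R) h g : Prop :=
  differentiable f h /\ forall v : 'cV[R]_n, 'd f h v = dot g v.

(* Meant for V a linear subspace. *)
Definition is_orthogonal_projection (V : set 'cV[R]_n) x p : Prop :=
  V p /\ forall y, V y -> dot (x - p) y = 0.

Definition ellipsoid (A : 'M[R]_n) : set 'cV[R]_n :=
  [set x | dot (A *m x) x = 1].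

Definition tangent_space (A : 'M[R]_n) h : set 'cV[R]_n :=
  [set x | dot (A *m h) x = 0].

Definition is_riemannian_gradient (A : 'M[R]_n) (f : 'cV[R]_n -> R) h
    (xi : 'cV[R]_n) : Prop :=
  exists2 g, is_gradient f h g &
             is_orthogonal_projection (tangent_space A h) g xi.

End Euclidean.

Section RiemannianGradientUnique.
Context {R : realType} {n : nat}.

Lemma dotBl (x y z : 'cV[R]_n) : dot (x - y) z = dot x z - dot y z.
Proof.
by rewrite /dot -sumrB; apply: eq_bigr => i _; rewrite !mxE mulrBl.
Qed.

Lemma dotC (x y : 'cV[R]_n) : dot x y = dot y x.
Proof. by apply: eq_bigr => i _; rewrite mulrC. Qed.

Lemma dot_eq0 (x : 'cV[R]_n) : dot x x = 0 -> x = 0.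
Proof.
move=> /eqP; rewrite psumr_eq0 => [/allP x0|i _]; last by rewrite -expr2 sqr_ge0.
apply/colP => i; rewrite mxE; apply/eqP.
by have := x0 i (mem_index_enum i); rewrite mulf_eq0 orbb.
Qed.

(* is_riemannian_gradient is a functional relation: "xi is the Riemannian
   gradient" is well defined. *)
Lemma is_riemannian_gradient_unique (A : 'M[R]_n) (f : 'cV[R]_n -> R)
    (h xi1 xi2 : 'cV[R]_n) :
  is_riemannian_gradient A f h xi1 -> is_riemannian_gradient A f h xi2 ->
  xi1 = xi2.
Proof.
move=> [g1 [_ d1] [T1 p1]] [g2 [_ d2] [T2 p2]].
have g12 : g1 = g2.
  apply/eqP; rewrite -subr_eq0; apply/eqP/dot_eq0.
  by rewrite dotBl -d1 -d2 subrr.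
have Td : tangent_space A h (xi1 - xi2).
  by rewrite /tangent_space /= dotC dotBl dotC T1 dotC T2 subrr.
apply/eqP; rewrite -subr_eq0; apply/eqP/dot_eq0.
have /eqP := p1 _ Td; rewrite dotBl subr_eq0 => /eqP e1.
have /eqP := p2 _ Td; rewrite -g12 dotBl subr_eq0 => /eqP e2.
by rewrite dotBl -e1 -e2 subrr.
Qed.

End RiemannianGradientUnique.

Section Objective.
Context {R : realType} {m r : nat}.
Implicit Types (W : 'M[R]_(m, r)) (w : 'cV[R]_m) (h : 'cV[R]_r).

Definition gram W : 'M[R]_r := W^T *m W.

Definition phi W w h : R := 1 - dot w (W *m h).

Definition normal_projector W h : 'M[R]_r :=
  (norm2 (gram W *m h) ^+ 2)^-1 *: ((gram W *m h) *m (gram W *m h)^T).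

Definition grad_plus W w h : 'cV[R]_r := normal_projector W h *m (W^T *m w).

Definition grad_minus W w : 'cV[R]_r := W^T *m w.

End Objective.

(* Main.v *)
Require Import Defs.
From HB Require Import structures.
From mathcomp Require Import all_boot all_order all_algebra.
From mathcomp Require Import all_classical all_reals all_analysis.
Import Order.TTheory GRing.Theory Num.Theory.
Import numFieldNormedType.Exports.
Local Open Scope classical_set_scope.
Local Open Scope ring_scope.

(** Moving [W] across the inner product ([dot_mulmxr]) shows that [phi] is affine, with constant
    Euclidean gradient [- (W^T *m w)] ([is_gradient_affine]). The tangent space is the hyperplane
    orthogonal to [a = gram W *m h], and [a] is nonzero because its product with [h] is 1;
    projecting onto it removes the component along [a] ([is_orthogonal_projection_hyperplane]).
    Expanding the projected gradient gives the splitting, and both parts are built from nonnegative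
    matrices by operations preserving the sign ([mulmx_ge0], [trmx_ge0]). *)

Section DotProduct.
Context {R : realType} {n : nat}.
Implicit Types x y a : 'cV[R]_n.

Lemma dotE x y : dot x y = (x^T *m y) 0 0.
Proof. by rewrite mxE; apply: eq_bigr => i _; rewrite mxE. Qed.

Lemma dot_linear a : linear (dot a).
Proof. by move=> k x y; rewrite !dotE mulmxDr -scalemxAr !mxE. Qed.

HB.instance Definition _ a :=
  GRing.isLinear.Build R 'cV[R]_n R *:%R (dot a) (dot_linear a).

Lemma norm2_sqr x : norm2 x ^+ 2 = dot x x.
Proof. by rewrite sqr_sqrtr // sumr_ge0 // => i _; rewrite -expr2 sqr_ge0. Qed.

Lemma dot_continuous a : continuous (dot a).
Proof.
rewrite /dot; apply: (continuous_big add_continuous) => i _ x.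
by apply: continuousM; [exact: cst_continuous | exact: coord_continuous].
Qed.

(** A continuous linear form is its own differential, and the constant contributes zero. *)
Lemma is_gradient_affine (c : R) a h :
  is_gradient (fun x => c + dot a x) h a.
Proof.
have dota : differentiable (dot a) h.
  exact: linear_differentiable (dot_continuous a).
split=> [|v]; first exact: differentiableD.
rewrite (diffD (differentiable_cst c h) dota) diff_cst.
rewrite (diff_lin _ (@dot_continuous a)); exact: add0r.
Qed.

Lemma outer_mulmx a x : a *m a^T *m x = dot a x *: a.
Proof.
by rewrite -mulmxA [a^T *m x]mx11_scalar -dotE mul_mx_scalar.
Qed.

(** The vector subtracted from [g] is [(dot a g / dot a a) *: a]: it has the same product with [a]
    as [g], and as a multiple of [a] it is orthogonal to the hyperplane. *)
Lemma is_orthogonal_projection_hyperplane a g : dot a a != 0 ->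
  is_orthogonal_projection [set x | dot a x = 0] g
    ((1%:M - (norm2 a ^+ 2)^-1 *: (a *m a^T)) *m g).
Proof.
move=> a0; rewrite norm2_sqr mulmxBl mul1mx -scalemxAl outer_mulmx.
split=> [/=|y /= ay].
  by rewrite linearB !linearZ /= /GRing.scale /= mulrCA mulrN mulVf // mulrN1 subrr.
by rewrite opprB addrC subrK dotC !linearZ /= (dotC y a) ay !scaler0.
Qed.

End DotProduct.

Lemma dot_mulmxr (R : realType) m n (W : 'M[R]_(m, n)) w x :
  dot w (W *m x) = dot (W^T *m w) x.
Proof. by rewrite !dotE trmx_mul trmxK mulmxA. Qed.

Lemma mulmx_ge0 (R : numDomainType) m n p (A : 'M[R]_(m, n)) (B : 'M[R]_(n, p)) :
  A \is a mxOver Num.nneg -> B \is a mxOver Num.nneg ->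
  A *m B \is a mxOver Num.nneg.
Proof.
move=> /mxOverP A0 /mxOverP B0; apply/mxOverP => i j.
by rewrite mxE rpred_sum // => k _; rewrite rpredM.
Qed.

Lemma trmx_ge0 (R : numDomainType) m n (A : 'M[R]_(m, n)) :
  A \is a mxOver Num.nneg -> A^T \is a mxOver Num.nneg.
Proof. by move=> /mxOverP A0; apply/mxOverP => i j; rewrite mxE. Qed.

Theorem mainTheorem2 (R : realType) (m r : nat)
    (W : 'M[R]_(m, r)) (w : 'cV[R]_m)
    (W_ge0 : W \is a mxOver Num.nneg) (W_rank : \rank W = r)
    (w_ge0 : w \is a mxOver Num.nneg)
    (h : 'cV[R]_r) (hE : ellipsoid (gram W) h)
    (h_ge0 : h \is a mxOver Num.nneg) :
  [/\ is_riemannian_gradient (gram W) (phi W w) h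
        ((1%:M - normal_projector W h) *m (- (W^T *m w))),
      (1%:M - normal_projector W h) *m (- (W^T *m w)) =
        grad_plus W w h - grad_minus W w,
      grad_plus W w h \is a mxOver Num.nneg
    & grad_minus W w \is a mxOver Num.nneg].
Proof.
have Ww_ge0 : W^T *m w \is a mxOver Num.nneg by rewrite mulmx_ge0 ?trmx_ge0.
have Ah_ge0 : gram W *m h \is a mxOver Num.nneg.
  by rewrite !mulmx_ge0 ?trmx_ge0.
split=> //.
- exists (- (W^T *m w)).
    have -> : phi W w = fun x => 1 + dot (- (W^T *m w)) x.
      (* [dot] is declared linear in its second argument only, so symmetry is used to extract the
         sign. *)
      by apply/funext => x; rewrite /phi dot_mulmxr [in RHS]dotC linearN /= dotC.
    exact: is_gradient_affine.
  apply: is_orthogonal_projection_hyperplane.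
  (* If [gram W *m h] vanished, the equation of the ellipsoid would read 0 = 1. *)
  apply/eqP => /dot_eq0 Ah0; move: hE; rewrite /ellipsoid /= Ah0 dotC linear0.
  by move/esym/eqP; rewrite oner_eq0.
- by rewrite mulmxBl mul1mx mulmxN opprK addrC.
- rewrite /grad_plus mulmx_ge0 //.
  have /mxOverP P_ge0 : (gram W *m h) *m (gram W *m h)^T \is a mxOver Num.nneg.
    by rewrite mulmx_ge0 ?trmx_ge0.
  by apply/mxOverP => i j; rewrite mxE rpredM // nnegrE invr_ge0 sqr_ge0.
Qed.
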